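(* Let $C$ be a closed convex cone in a real vector space and let $f: C\times C\rightarrow\mathbb{R}$ be a function which is symmetric, $f(u,v)=f(v,u)$ for all $u,v\in C$, bilinear in the sense that $$f(\lambda^1u_1+\lambda^2u_2,\ \mu^1v_1+\mu^2v_2)=\sum_{i,j=1}^2\lambda^i\mu^jf(u_i,v_j)$$ for all real $\lambda^i,\mu^i\geq0$ and all $u_i,v_i\in C$ $(i=1,2)$, and which satisfies $$\big[f(u,v)\big]^2\geq f(u,u)\cdot f(v,v)\qquad\text{for all } u,v\in C.$$ Let $r\geq 1$ be an integer, choose arbitrary elements $u_0,u_1,\ldots,u_r\in C$, and denote $d_{ij}:=f(u_i,u_j)$ for $0\leq i,j\leq r$. Then the $r\times r$ matrix $$\big(d_{0i}d_{0j}-d_{00}d_{ij}\big)_{i,j=1}^r$$ is positive semi-definite. Furthermore, $$0\leq\det\Big(\big(d_{0i}d_{0j}-d_{00}d_{ij}\big)_{i,j=1}^r\Big)=(-1)^r\cdot d_{00}^{\,r-1}\cdot\det\Big(\big(d_{ij}\big)_{i,j=0}^r\Big).$$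
   Context: The superscripts on $\lambda^i,\mu^j$ are indices, not powers, while $d_{00}^{\,r-1}$ is a power, with the convention $d_{00}^{\,0}=1$. A convex cone is a nonempty subset closed under linear combinations with nonnegative real coefficients; closedness is with respect to the usual topology (e.g. of a Euclidean space). *)

(* Defs.v *)
From HB Require Import structures.
From mathcomp Require Import all_boot all_order all_algebra.
From mathcomp Require Import all_classical all_reals all_analysis.

Set Implicit Arguments.
Unset Strict Implicit.
Unset Printing Implicit Defensive.

Import Order.TTheory GRing.Theory Num.Theory.

Local Open Scope classical_set_scope.
Local Open Scope ring_scope.

Definition convex_cone (R : realType) (V : lmodType R) (C : set V) : Prop :=
  C !=set0 /\
  forall (n : nat) (a : 'I_n -> R) (u : 'I_n -> V),
    (forall i, 0 <= a i) -> (forall i, C (u i)) -> C (\sum_i a i *: u i).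

(* A function C x C -> R is represented by a total function on V x V of which
   only the values on C x C are constrained or used. *)
Definition cone_symmetric (R : realType) (V : lmodType R) (C : set V)
    (f : V -> V -> R) : Prop :=
  forall u v, C u -> C v -> f u v = f v u.

Definition cone_bilinear (R : realType) (V : lmodType R) (C : set V)
    (f : V -> V -> R) : Prop :=
  forall (a b : 'I_2 -> R) (u v : 'I_2 -> V),
    (forall i, 0 <= a i) -> (forall i, 0 <= b i) ->
    (forall i, C (u i)) -> (forall i, C (v i)) ->
    f (\sum_i a i *: u i) (\sum_j b j *: v j) =
    \sum_i \sum_j a i * b j * f (u i) (v j).

Definition psdmx (R : realType) (n : nat) (A : 'M[R]_n) : Prop :=
  A^T = A /\ forall x : 'cV[R]_n, 0 <= (x^T *m A *m x) 0 0.

Definition gram_mx (R : realType) (V : lmodType R) (f : V -> V -> R) (n : nat)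
    (u : 'I_n -> V) : 'M[R]_n :=
  \matrix_(i, j) f (u i) (u j).

(* For d indexed by 0, ..., r, the entry in position (i, j), 1 <= i, j <= r, is
   d_0i d_0j - d_00 d_ij; the ordinal i : 'I_r stands for the index
   lift ord0 i, whose value is i.+1. *)
Definition reduced_mx (R : realType) (r : nat) (d : 'M[R]_r.+1) : 'M[R]_r :=
  \matrix_(i, j) (d ord0 (lift ord0 i) * d ord0 (lift ord0 j)
                  - d ord0 ord0 * d (lift ord0 i) (lift ord0 j)).

(* Main.v *)
(* In coordinates the hypothesis is a reverse Cauchy-Schwarz inequality for the
   bilinear form with Gram matrix d, between vectors of the closed positive
   orthant. It says that the form has nonpositive discriminant on the plane
   spanned by the two vectors. Every plane through a point b of the open orthant
   is spanned by b and some b + t x in the orthant, so the inequality holds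
   between b and an arbitrary vector x, and by continuity between e_0 and x; for
   x supported on the indices 1, ..., r this is positivity of the reduced matrix.
   The determinant identity is Schur complementation with respect to d_00; when
   d_00 = 0 the reduced matrix has rank at most 1. *)
Require Import Defs.
From HB Require Import structures.
From mathcomp Require Import all_boot all_order all_algebra.
From mathcomp Require Import all_classical all_reals all_analysis.
From mathcomp Require Import ring lra.

Set Implicit Arguments.
Unset Strict Implicit.
Unset Printing Implicit Defensive.

Import Order.TTheory GRing.Theory Num.Theory.

Local Open Scope classical_set_scope.
Local Open Scope ring_scope.

(** * Bilinear forms in coordinates and the reversed inequality *)

Section Bform.
Variables (R : realFieldType) (n : nat) (D : 'M[R]_n).

Definition bform (x y : 'cV[R]_n) : R := (x^T *m D *m y) 0 0.

Lemma bformDl x y z : bform (x + y) z = bform x z + bform y z.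
Proof. by rewrite /bform linearD /= !mulmxDl mxE. Qed.

Lemma bformDr x y z : bform z (x + y) = bform z x + bform z y.
Proof. by rewrite /bform mulmxDr mxE. Qed.

Lemma bformZl t x z : bform (t *: x) z = t * bform x z.
Proof. by rewrite /bform linearZ /= -!scalemxAl mxE. Qed.

Lemma bformZr t x z : bform z (t *: x) = t * bform z x.
Proof. by rewrite /bform -scalemxAr mxE. Qed.

Lemma bformC x y : D^T = D -> bform x y = bform y x.
Proof.
move=> Dsym; rewrite /bform.
have -> : y^T *m D *m x = (x^T *m D *m y)^T.
  by rewrite !trmx_mul trmxK Dsym mulmxA.
by rewrite [RHS]mxE.
Qed.

Lemma bformE x y : bform x y = \sum_i \sum_j x i 0 * y j 0 * D i j.
Proof.
rewrite /bform -mulmxA mxE; apply: eq_bigr => i _.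
rewrite !mxE mulr_sumr; apply: eq_bigr => j _.
by rewrite -mulrA [y j 0 * _]mulrC.
Qed.

(** This replaces the limit [e -> 0+]. If [c < 0], then [e = - c / k] satisfies [e <= 1] and [(|a| +
    |b|) * e = - c - e * (1 - c) < - c], so the quadratic is negative at [e]. *)
Lemma quadratic_ge0_at0 (a b c : R) :
  (forall e, 0 < e -> 0 <= c + b * e + a * e ^+ 2) -> 0 <= c.
Proof.
move=> pos; rewrite leNgt; apply/negP => c_lt0.
pose k := `|a| + `|b| + 1 - c.
have k_gt0 : 0 < k.
  by rewrite /k; have := normr_ge0 a; have := normr_ge0 b; lra.
pose e := - c / k.
have e_gt0 : 0 < e by rewrite divr_gt0 // oppr_gt0.
have ek : e * k = - c by rewrite divfK // gt_eqF.
have e_le1 : e <= 1.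
  rewrite ler_pdivrMr // mul1r /k.
  by have := normr_ge0 a; have := normr_ge0 b; lra.
have be : b * e <= `|b| * e by rewrite ler_pM2r // ler_norm.
have ae : a * e ^+ 2 <= `|a| * e.
  apply: (@le_trans _ _ (`|a| * e ^+ 2)).
    by rewrite ler_wpM2r ?sqr_ge0 ?ler_norm.
  by rewrite ler_wpM2l // expr2 ler_piMl // ltW.
have := pos e e_gt0; have : 0 < e * (1 - c) by rewrite mulr_gt0 //; lra.
rewrite /k in ek; nra.
Qed.

Lemma reverse_cauchy_schwarz_orthant :
    D^T = D ->
    (forall x y : 'cV_n, (forall i, 0 <= x i 0) -> (forall i, 0 <= y i 0) ->
       bform x x * bform y y <= bform x y ^+ 2) ->
  forall a x : 'cV_n, (forall i, 0 <= a i 0) ->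
    bform a a * bform x x <= bform a x ^+ 2.
Proof.
move=> Dsym rcs a x a_ge0.
pose o : 'cV[R]_n := const_mx 1.
rewrite -subr_ge0.
(* These are the coefficients of [e ^+ 2] and [e] in [bform b x ^+ 2 - bform b b * bform x x] for
   [b = a + e *: o]; the constant term is the goal. *)
apply: (@quadratic_ge0_at0
  (bform o x ^+ 2 - bform o o * bform x x)
  (2 * (bform a x * bform o x - bform a o * bform x x))) => e e_gt0.
pose b := a + e *: o.
have b_ge i : e <= b i 0 by rewrite !mxE mulr1 lerDr.
(* [s] bounds every [|x i 0|], so with [t = e / s] the perturbation [t *: x] has entries at most [e]
   in absolute value, and [b + t *: x] stays in the orthant. *)
pose s := 1 + \sum_i `|x i 0|.
have sum_ge0 : 0 <= \sum_i `|x i 0| by apply: sumr_ge0.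
have s_gt0 : 0 < s by rewrite /s; lra.
pose t := e / s.
have t_gt0 : 0 < t by rewrite divr_gt0.
have ts : t * s = e by rewrite divfK // gt_eqF.
have b_ge0 i : 0 <= b i 0 := le_trans (ltW e_gt0) (b_ge i).
have btx_ge0 i : 0 <= (b + t *: x) i 0.
  rewrite mxE [(t *: x) i 0]mxE.
  have xs : `|x i 0| <= s.
    rewrite /s (bigD1 i) //=.
    have : 0 <= \sum_(j | j != i) `|x j 0| by apply: sumr_ge0.
    lra.
  have := ler_norm (- x i 0); rewrite normrN => xn.
  have := b_ge i; nra.
have := rcs b (b + t *: x) b_ge0 btx_ge0; rewrite -subr_ge0.
rewrite !(bformDl, bformDr, bformZl, bformZr) (bformC x a) // (bformC x o) //.
rewrite (bformC o a) //.
set aa := bform a a; set ao := bform a o; set oo := bform o o.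
set ax := bform a x; set ox := bform o x; set xx := bform x x.
(* Replacing [x] by [b + t *: x] multiplies the discriminant by [t ^+ 2], which is cancelled
   here. *)
move=> ge0; rewrite -(pmulr_rge0 _ (exprn_gt0 2 t_gt0)).
by apply: le_trans ge0 _; rewrite le_eqVlt; apply/orP; left; apply/eqP; ring.
Qed.

End Bform.

(** * Determinants *)

(* The determinant of [s I + (1 - s) A] is polynomial in [s], is [1] at [s = 1]
   and does not vanish on [0 < s <= 1]. *)
Lemma det_psd_ge0 (R : rcfType) (n : nat) (A : 'M[R]_n) :
  (forall x : 'cV[R]_n, 0 <= (x^T *m A *m x) 0 0) -> 0 <= \det A.
Proof.
move=> Apsd; rewrite leNgt; apply/negP => detA_lt0.
pose M : 'M[{poly R}]_n := 'X%:M + (1 - 'X) *: map_mx polyC A.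
have detM s : (\det M).[s] = \det (s%:M + (1 - s) *: A).
  rewrite -[LHS]/(horner_eval s (\det M)) -det_map_mx; congr (\det _).
  apply/matrixP=> i j; rewrite !mxE /= /horner_eval.
  by rewrite !(hornerE, hornerMn).
have := @poly_ivt _ (\det M) 0 1 ler01.
rewrite !detM subr0 subrr scale1r scale0r addr0 det1 raddf0 add0r ler01.
rewrite (ltW detA_lt0); case=> // s /andP[s_ge0 s_le1] /rootP.
rewrite detM => dets.
have : \det (s%:M + (1 - s) *: A)^T == 0 by rewrite det_tr dets.
case/det0P => v v_neq0 vM.
have s_gt0 : 0 < s.
  rewrite lt_neqAle s_ge0 andbT; apply/eqP => s0.
  move: dets detA_lt0; rewrite -s0 subr0 scale1r raddf0 add0r => ->.
  by rewrite ltxx.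
have := Apsd v^T; rewrite trmxK.
set q := (v *m A *m v^T) 0 0 => q_ge0.
(* Pairing the kernel relation with [v] gives a sum of a positive and a nonnegative term. Since [A]
   need not be symmetric, [q] is first identified with its transpose. *)
have eq0 : s * (v *m v^T) 0 0 + (1 - s) * q = 0.
  have <- : (v *m (s%:M + (1 - s) *: A)^T *m v^T) 0 0 = 0.
    by rewrite vM mul0mx mxE.
  have -> : q = (v *m A^T *m v^T) 0 0.
    rewrite /q -[in LHS](trmxK (v *m A *m v^T)) [LHS]mxE.
    by rewrite !trmx_mul trmxK mulmxA.
  rewrite linearD /= linearZ /= tr_scalar_mx mulmxDr mulmxDl mul_mx_scalar.
  rewrite -scalemxAl -scalemxAr -scalemxAl.
  have E (M1 M2 : 'M[R]_1) :
      (s *: M1 + (1 - s) *: M2) 0 0 = s * M1 0 0 + (1 - s) * M2 0 0.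
    by rewrite !mxE.
  by rewrite E.
have vv : 0 < (v *m v^T) 0 0.
  have [i vi] := rV0Pn v v_neq0.
  rewrite mxE (bigD1 i) //= !mxE ltr_pwDl //.
    by rewrite -expr2 exprn_even_gt0.
  by apply: sumr_ge0 => j _; rewrite !mxE -expr2 sqr_ge0.
have := mulr_gt0 s_gt0 vv; nra.
Qed.

Lemma det_block_mx11 (R : comNzRingType) (a b c d : 'M[R]_1) :
  \det (block_mx a b c d) = a 0 0 * d 0 0 - b 0 0 * c 0 0.
Proof.
have l0 : (ord0 : 'I_(1 + 1)) = lshift 1 (0 : 'I_1) by apply: val_inj.
have r0 : lift (ord0 : 'I_(1 + 1)) 0 = rshift 1 (0 : 'I_1) by apply: val_inj.
have l1 : lift (rshift 1 (0 : 'I_1)) 0 = lshift 1 (0 : 'I_1) by apply: val_inj.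
have det2 (M : 'M[R]_(1 + 1)) : \det M =
    M (lshift 1 0) (lshift 1 0) * M (rshift 1 0) (rshift 1 0)
    - M (lshift 1 0) (rshift 1 0) * M (rshift 1 0) (lshift 1 0).
  rewrite (expand_det_row _ (lshift 1 0)) big_split_ord /= !big_ord1.
  by rewrite /cofactor !det_mx11 !mxE -l0 !r0 l1 l0 /= expr0 expr1 mul1r mulN1r mulrN.
by rewrite det2 block_mxEul block_mxEur block_mxEdl block_mxEdr.
Qed.

(** For [a != 0], block column elimination clears [b]; comparing determinants gives the identity
    with one extra factor [a] on both sides. *)
Lemma det_rank1_reduction (R : fieldType) (m : nat) (a : R)
    (b : 'rV[R]_m.+1) (c : 'cV[R]_m.+1) (D : 'M[R]_m.+1) :
  \det (c *m b - a *: D) =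
  (-1) ^+ m.+1 * a ^+ m * \det (block_mx a%:M b c D).
Proof.
have [->|a_neq0] := eqVneq a 0.
  (* For [m = 0] the factor [a ^+ m] is 1 even at [a = 0], so the 2 x 2 case is computed. For larger
     [m] the right side vanishes and [c *m b] has rank at most 1, hence is singular. *)
  rewrite scale0r subr0; case: m b c D => [|m] b c D.
    by rewrite det_block_mx11 det_mx11 !mxE big_ord1 /=; ring.
  rewrite [0 ^+ _]exprS mul0r mulr0 mul0r; apply/eqP.
  rewrite -[_ == _]negbK -unitfE -unitmxE -row_free_unit /row_free.
  by apply/eqP => rk; have := mulmx_max_rank c b; rewrite rk.
have /(congr1 determinant) : block_mx a%:M b c D *m block_mx 1%:M (- b) 0 a%:M =
    block_mx (a%:M : 'M[R]_1) 0 c (- (c *m b - a *: D)).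
  rewrite mulmx_block !mulmx1 !mulmx0 !addr0 mul_scalar_mx !mul_mx_scalar.
  by rewrite scalerN addNr mulmxN opprB addrC.
rewrite det_mulmx det_ublock det_lblock det1 mul1r !det_scalar expr1.
rewrite -scaleN1r detZ exprS mulrCA => /(mulfI a_neq0) eqd.
by rewrite -mulrA [_ ^+ m * _]mulrC eqd mulrA -exprMn mulrNN mulr1 expr1n mul1r.
Qed.

(** * From the cone to coordinates *)

Section ConeForm.
Variables (R : realType) (V : lmodType R) (C : set V) (f : V -> V -> R).
Hypotheses (C_cone : convex_cone C) (f_sym : cone_symmetric C f).
Hypothesis f_bilin : cone_bilinear C f.

Lemma cone_form_combl (s t : R) (x y z : V) :
  0 <= s -> 0 <= t -> C x -> C y -> C z ->
  f (s *: x + t *: y) z = s * f x z + t * f y z.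
Proof.
move=> s0 t0 Cx Cy Cz.
pose a (i : 'I_2) := if i == ord0 then s else t.
(* Weights 1 and 0 on two copies of [z] recover [z] in the second slot. *)
pose b (i : 'I_2) : R := if i == ord0 then 1 else 0.
pose v (i : 'I_2) := if i == ord0 then x else y.
have := @f_bilin a b v (fun=> z).
rewrite !big_ord_recl !big_ord0 /a /b /v /=.
rewrite !scale0r scale1r !addr0 !mulr0 !mul0r !mulr1 !addr0.
by apply=> [i|i|i|i] //; case: ifP.
Qed.

Lemma cone_form_suml n (a : 'I_n -> R) (v : 'I_n -> V) (z : V) :
  (forall i, 0 <= a i) -> (forall i, C (v i)) -> C z ->
  f (\sum_i a i *: v i) z = \sum_i a i * f (v i) z.
Proof.
elim: n a v => [|n IHn] a v a_ge0 Cv Cz.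
  (* The empty sum is [0 *: z + 0 *: z], whence [f 0 z = 0]. *)
  have := @cone_form_combl 0 0 z z z (lexx _) (lexx _) Cz Cz Cz.
  by rewrite !big_ord0 !scale0r !mul0r !addr0.
rewrite !big_ord_recl -[X in f (_ + X)]scale1r cone_form_combl //.
  by rewrite mul1r IHn.
by apply: C_cone.2.
Qed.

Lemma cone_form_bform n (v : 'I_n -> V) (x y : 'cV[R]_n) :
  (forall i, 0 <= x i 0) -> (forall i, 0 <= y i 0) -> (forall i, C (v i)) ->
  f (\sum_i x i 0 *: v i) (\sum_j y j 0 *: v j) = bform (gram_mx f v) x y.
Proof.
move=> x_ge0 y_ge0 Cv.
have Cy : C (\sum_j y j 0 *: v j) by apply: C_cone.2.
rewrite (cone_form_suml x_ge0 Cv Cy) bformE; apply: eq_bigr => i _.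
rewrite f_sym // (cone_form_suml y_ge0 Cv (Cv i)) mulr_sumr.
by apply: eq_bigr => j _; rewrite mxE mulrA (f_sym (Cv j) (Cv i)).
Qed.

End ConeForm.

(** * The reduced matrix: its quadratic form and determinant *)

Lemma reduced_mx_bform (R : realType) (r : nat) (d : 'M[R]_r.+1)
    (x : 'cV[R]_r) :
  let X : 'cV_r.+1 := col_mx (0 : 'cV_1) x in
  let e0 : 'cV_r.+1 := delta_mx ord0 0 in
  bform (reduced_mx d) x x = bform d e0 X ^+ 2 - bform d e0 e0 * bform d X X.
Proof.
move=> X e0.
have X0 : X ord0 0 = 0.
  have -> : (ord0 : 'I_r.+1) = lshift r (ord0 : 'I_1) by apply: val_inj.
  by apply: etrans (col_mxEu _ _ _ _) _; rewrite mxE.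
have XS i : X (lift ord0 i) 0 = x i 0.
  have -> : lift ord0 i = rshift 1 i by apply: val_inj.
  exact: col_mxEd.
have e0Y (Y : 'cV_r.+1) : bform d e0 Y = \sum_j d ord0 j * Y j 0.
  rewrite /bform trmx_delta -rowE mxE.
  by apply: eq_bigr => j _; rewrite mxE.
have -> : bform d e0 e0 = d ord0 ord0.
  rewrite e0Y (bigD1 ord0) //= big1 => [|j /negbTE j0]; rewrite mxE ?j0 ?mulr0 //.
  by rewrite !eqxx mulr1 addr0.
have e0X : bform d e0 X = \sum_i d ord0 (lift ord0 i) * x i 0.
  by rewrite e0Y big_ord_recl X0 mulr0 add0r; under eq_bigr do rewrite XS.
have XX : bform d X X =
    \sum_i \sum_j x i 0 * x j 0 * d (lift ord0 i) (lift ord0 j).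
  rewrite bformE big_ord_recl big1 ?add0r => [|j _]; last by rewrite X0 !mul0r.
  apply: eq_bigr => i _; rewrite big_ord_recl X0 mulr0 mul0r add0r.
  by under eq_bigr do rewrite !XS.
rewrite e0X XX bformE expr2 mulr_suml mulr_sumr -sumrB; apply: eq_bigr => i _.
rewrite !mulr_sumr -sumrB; apply: eq_bigr => j _.
by rewrite mxE; ring.
Qed.

Lemma det_reduced_mx (R : realType) (m : nat) (d : 'M[R]_m.+2) :
  d^T = d ->
  \det (reduced_mx d) = (-1) ^+ m.+1 * d ord0 ord0 ^+ m * \det d.
Proof.
move=> d_sym.
have o0 : (ord0 : 'I_m.+2) = lshift m.+1 (ord0 : 'I_1) by apply: val_inj.
have oS (i : 'I_m.+1) : lift ord0 i = rshift 1 i by apply: val_inj.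
pose d' : 'M[R]_(1 + m.+1) := d.
have -> : reduced_mx d =
    dlsubmx d' *m ursubmx d' - d ord0 ord0 *: drsubmx d'.
  apply/matrixP => i j; rewrite !mxE big_ord1 !mxE !oS o0.
  (* Symmetry turns the row entry [d_0i] into the entry [d_i0] of the left column block. *)
  by congr (_ * _ - _); rewrite -[in LHS]d_sym mxE.
rewrite det_rank1_reduction; congr (_ * \det _).
rewrite -[RHS](submxK d'); congr block_mx.
by rewrite [RHS]mx11_scalar !mxE o0.
Qed.

Theorem theorem3p5 (R : realType) (V : topologicalLmodType R) (C : set V)
    (C_closed : closed C) (C_cone : convex_cone C)
    (f : V -> V -> R)
    (f_sym : cone_symmetric C f)
    (f_bilin : cone_bilinear C f)
    (f_ineq : forall u v : V, C u -> C v -> f u u * f v v <= f u v ^+ 2)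
    (r : nat) (r_ge1 : (1 <= r)%N)
    (u : 'I_r.+1 -> V) (u_in : forall i, C (u i)) :
  let d : 'M[R]_r.+1 := gram_mx f u in
  psdmx (reduced_mx d) /\
  0 <= \det (reduced_mx d) /\
  \det (reduced_mx d) = (-1) ^+ r * d ord0 ord0 ^+ r.-1 * \det d.
Proof.
move=> d.
have d_sym : d^T = d by apply/matrixP => i j; rewrite !mxE f_sym.
have red_ge0 (x : 'cV[R]_r) : 0 <= (x^T *m reduced_mx d *m x) 0 0.
  rewrite -/(bform _ x x) reduced_mx_bform subr_ge0.
  (* Only [e_0] has to lie in the orthant; the entries of [x] may have any sign. *)
  apply: reverse_cauchy_schwarz_orthant => // [y z y_ge0 z_ge0|i].
    rewrite -!(cone_form_bform C_cone f_sym f_bilin) //.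
    by apply: f_ineq; apply: C_cone.2.
  by rewrite mxE ler0n.
split; last split.
- split=> //; apply/matrixP => i j; rewrite !mxE.
  by rewrite (f_sym (u (lift ord0 i))) // [X in X - _]mulrC.
- exact: det_psd_ge0.
case: r r_ge1 u u_in d d_sym red_ge0 => // m _ u u_in d d_sym _.
exact: det_reduced_mx.
Qed.
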